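(* Consider the parameterized family of continuous-time Markov decision processes described in the context, and suppose that the perturbations affect only the reward: $\lambda^a_{ss',\tilde\theta}=\lambda^a_{ss',\theta}$ for all $\tilde\theta\in\Theta$, $s,s'\in\mathcal S$, $a\in\mathcal A_s$ (so $\mathbb P^\pi_{\tilde\theta}=\mathbb P^\pi_\theta$), where $\theta\in\Theta$ is the fixed baseline parameter. Let $\pi\in\Pi$, $\tau>0$ and $\varepsilon\ge 0$. Define $$\widehat{\mathcal C}_{\tau,\varepsilon}^\pi(\theta):=\Big\{\tilde\theta\in\Theta\ \Big|\ \tau\log\Big[\sum_{s\in\mathcal S}\bar{\mathrm d}^\pi_{\rho,\theta}(s)\sum_{a\in\mathcal A_s}\mu(a|s)\exp\Big(\tfrac{R_\theta(s,a)-R_{\tilde\theta}(s,a)}{\tau}\Big)\Big]\le\varepsilon\Big\}.$$ Then $$\inf_{\tilde\theta\in\widehat{\mathcal C}_{\tau,\varepsilon}^\pi(\theta)}\mathbb E_\rho^{\mathbb P^\pi_\theta}\Big[\int_0^\infty e^{-rt}\sum_{a\in\mathcal A_{S_t}}\pi(a|S_t)R_{\tilde\theta}(S_t,a)\,\mathrm dt\Big]\ \ge\ J_\tau(\pi;\theta)-\frac{\varepsilon}{r},$$ where $$J_\tau(\pi;\theta):=\mathbb E_\rho^{\mathbb P^\pi_\theta}\Big[\int_0^\infty e^{-rt}\Big(\sum_{a\in\mathcal A_{S_t}}\pi(a|S_t)R_\theta(S_t,a)-\tau\,\mathrm{KL}(\pi\|\mu)(S_t)\Big)\mathrm dt\Big].$$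 Moreover, equality holds if there exists $\tilde\theta^*\in\Theta$ such that $$R_{\tilde\theta^*}(s,a)=R_\theta(s,a)-\tau\log\frac{\pi(a|s)}{\mu(a|s)}-\varepsilon\qquad\text{for all } s\in\mathcal S,\ a\in\mathcal A_s,$$ and in this case $\tilde\theta^*$ is a worst-case model, i.e. $\tilde\theta^*\in\widehat{\mathcal C}_{\tau,\varepsilon}^\pi(\theta)$ and it attains the infimum.
   Context: $\mathcal S$ and $\mathcal A$ are finite state and action spaces; for each $s\in\mathcal S$, $\mathcal A_s\subseteq\mathcal A$ is a nonempty set of available actions. $\Theta$ is a parameter set. For each $\vartheta\in\Theta$, $s\in\mathcal S$, $a\in\mathcal A_s$ there are transition rates $\lambda^a_{ss',\vartheta}\ge 0$ for $s'\ne s$, with $\lambda^a_{ss,\vartheta}=-\sum_{s'\neq s}\lambda^a_{ss',\vartheta}$, and a reward function $R_\vartheta:\mathcal S\times\mathcal A\to(0,\infty)$. A baseline $\theta\in\Theta$ is fixed. The policy class is $\Pi:=\{\pi:\mathcal S\to\mathcal P(\mathcal A)\mid \sum_{a\in\mathcal A_s}\pi(a|s)=1\ \forall s\in\mathcal S\}$, where $\mathcal P(\cdot)$ denotes probability measures. Fix an initial distribution $\rho\in\mathcal P(\mathcal S)$ and a discount rate $r>0$. For $\pi\in\Pi$ and $\vartheta\in\Theta$, $\mathbb P^\pi_\vartheta$ is the law of the continuous-time Markov chain $(S_t)_{t\ge0}$ on $\mathcal S$ with initial distribution $\rho$ and generator $\lambda^\pi_{ss',\vartheta}:=\sum_{a\in\mathcal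 A_s}\pi(a|s)\lambda^a_{ss',\vartheta}$; $\mathbb E_\rho^{\mathbb P^\pi_\vartheta}$ is the corresponding expectation. The reference policy $\mu:\mathcal S\to\mathcal P(\mathcal A)$ satisfies $\operatorname{supp}\mu(\cdot|s)=\mathcal A_s$ for all $s$, and $\mathrm{KL}(\pi\|\mu)(s):=\sum_{a\in\mathcal A_s}\pi(a|s)\log\frac{\pi(a|s)}{\mu(a|s)}$ with the convention $0\log(0/x)=0$. The normalized discounted state occupancy measure is $\bar{\mathrm d}^\pi_{\rho,\vartheta}(s):=r\,\mathbb E_\rho^{\mathbb P^\pi_\vartheta}\big[\int_0^\infty e^{-rt}\mathbf 1_{\{S_t=s\}}\,\mathrm dt\big]$, $s\in\mathcal S$. The infimum over the empty set is $+\infty$. *)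

(* Defs.v *)
From HB Require Import structures.
From mathcomp Require Import all_boot all_order all_algebra.
From mathcomp Require Import all_classical all_reals all_analysis.

Set Implicit Arguments.
Unset Strict Implicit.
Unset Printing Implicit Defensive.

Import Order.TTheory GRing.Theory Num.Theory.
Import numFieldNormedType.Exports.

Local Open Scope classical_set_scope.
Local Open Scope ring_scope.

Record fdist (R : realType) (T : finType) := FDist {
  fdist_fun :> T -> R ;
  fdist_ge0 : forall x, 0 <= fdist_fun x ;
  fdist_sum1 : \sum_x fdist_fun x = 1 }.

(* [rate th s a s'] is lambda^a_{s s', th}; it is constrained only for
   available actions [a]. *)
Record ctmdp (R : realType) (S A : finType) (Theta : Type) := CTMDP {
  avail : S -> {set A} ;
  avail_neq0 : forall s, avail s != finset.set0 ;
  rate : Theta -> S -> A -> S -> R ;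
  rate_ge0 : forall th s a s', a \in avail s -> s' != s -> 0 <= rate th s a s' ;
  rate_diag : forall th s a, a \in avail s ->
    rate th s a s = - \sum_(s' | s' != s) rate th s a s' ;
  reward : Theta -> S -> A -> R ;
  reward_gt0 : forall th s a, 0 < reward th s a }.

Record policy (R : realType) (S A : finType) (Theta : Type)
    (M : ctmdp R S A Theta) := Policy {
  policy_fun :> S -> fdist R A ;
  policy_avail : forall s, \sum_(a in avail M s) policy_fun s a = 1 }.

Definition generator (R : realType) (S A : finType) (Theta : Type)
    (M : ctmdp R S A Theta) (pi : policy M) (th : Theta) (s s' : S) : R :=
  \sum_(a in avail M s) pi s a * rate M th s a s'.

(* Kolmogorov's forward equation, whose unique solution is p t = exp (t Q).
   The equation is stated on all of R, which avoids one-sided derivatives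
   at 0; only nonnegative times are used below. *)
Definition is_transition_function (R : realType) (S : finType)
    (Q : S -> S -> R) (p : R -> S -> S -> R) : Prop :=
  (forall s s', p 0 s s' = (s == s')%:R) /\
  (forall (t : R) s s',
     is_derive t 1 (fun u : R => p u s s') (\sum_z p t s z * Q z s')).

(* X is, under P, a right-continuous Markov chain with initial law rho and
   generator Q; only the times t >= 0 matter.  The Markov property is stated
   without conditional probabilities: the event
   [all (fun q => X q.1 w == q.2) h] is an arbitrary cylinder of the past. *)
Record is_ctmc (R : realType) (S : finType) (d : measure_display)
    (Omega : measurableType d) (rho : S -> R) (Q : S -> S -> R)
    (P : probability Omega R) (X : R -> Omega -> S) : Prop := IsCTMC {
  ctmc_meas : forall (t : R) s, 0 <= t -> measurable [set w | X t w = s] ;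
  ctmc_right_cont : forall w (t : R), 0 <= t -> \forall u \near t^'+, X u w = X t w ;
  ctmc_init : forall s, P [set w | X 0 w = s] = (rho s)%:E ;
  ctmc_markov : exists2 p, is_transition_function Q p &
    forall (h : seq (R * S)) (t u : R) (s s' : S),
      all (fun q : R * S => 0 <= q.1 <= t) h -> 0 <= t -> t <= u ->
      P [set w | [/\ all (fun q => X q.1 w == q.2) h, X t w = s & X u w = s']]
      = (P [set w | all (fun q => X q.1 w == q.2) h /\ X t w = s]
         * (p (u - t) s s')%:E)%E }.

(* E [ \int_0^oo e^{-rt} f (S_t) dt ] *)
Definition discounted (R : realType) (S : finType) (d : measure_display)
    (Omega : measurableType d) (P : probability Omega R) (X : R -> Omega -> S)
    (r : R) (f : S -> R) : \bar R :=
  ('E_P[fun w => (\int[lebesgue_measure]_(t in `[0, +oo[)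
                   (expR (- (r * t)) * f (X t w)))%R])%E.

(* [fine] is harmless: the expectation lies in [0, 1/r]. *)
Definition occupancy (R : realType) (S : finType) (d : measure_display)
    (Omega : measurableType d) (P : probability Omega R) (X : R -> Omega -> S)
    (r : R) (s : S) : R :=
  r * fine (discounted P X r (fun x => (x == s)%:R)).

(* [ln 0 = 0] in the library, so terms with [pi s a = 0] vanish as in the
   convention 0 log (0/x) = 0. *)
Definition KL (R : realType) (S A : finType) (Theta : Type)
    (M : ctmdp R S A Theta) (pi : policy M) (mu : S -> fdist R A) (s : S) : R :=
  \sum_(a in avail M s) pi s a * ln (pi s a / mu s a).

Definition value (R : realType) (S A : finType) (Theta : Type)
    (M : ctmdp R S A Theta) (d : measure_display) (Omega : measurableType d)
    (P : probability Omega R) (X : R -> Omega -> S) (r : R)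
    (pi : policy M) (th : Theta) : \bar R :=
  discounted P X r (fun s => \sum_(a in avail M s) pi s a * reward M th s a).

Definition reg_value (R : realType) (S A : finType) (Theta : Type)
    (M : ctmdp R S A Theta) (d : measure_display) (Omega : measurableType d)
    (P : probability Omega R) (X : R -> Omega -> S) (r : R)
    (mu : S -> fdist R A) (tau : R) (pi : policy M) (th : Theta) : \bar R :=
  discounted P X r (fun s =>
    (\sum_(a in avail M s) pi s a * reward M th s a) - tau * KL pi mu s).

Definition ambiguity_set (R : realType) (S A : finType) (Theta : Type)
    (M : ctmdp R S A Theta) (d : measure_display) (Omega : measurableType d)
    (P : probability Omega R) (X : R -> Omega -> S) (r : R)
    (mu : S -> fdist R A) (tau eps : R) (th : Theta) : set Theta :=
  [set th' | tau * ln (\sum_s occupancy P X r s *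
     \sum_(a in avail M s)
        mu s a * expR ((reward M th s a - reward M th' s a) / tau)) <= eps].

(* Main.v *)
(** Averaging over time and paths is integration against the occupancy measure:
    [E (int e^{-rt} f (S_t) dt) = r^-1 * sum_s occ s * f s].  Since [occ] is a
    probability on states, [occ s * pi s a] and [occ s * mu s a] define
    probabilities on state-action pairs, whose relative entropy is the
    [occ]-average of KL.  The Gibbs (Donsker-Varadhan) inequality applied to
    [(R_theta - R_th') / tau] is then the lower bound, and the worst-case reward
    is the exponential tilt for which that inequality is an equality. *)

Require Import Defs.
From mathcomp Require Import all_boot all_order all_algebra.
From mathcomp Require Import ring lra.
From mathcomp Require Import all_classical all_reals all_analysis.
From mathcomp Require Import measurable_realfun.

Import Order.TTheory GRing.Theory Num.Theory.
Import numFieldNormedType.Exports.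

Local Open Scope classical_set_scope.
Local Open Scope ring_scope.

(** * Gibbs variational inequality on finite sets *)

Lemma ln_le_subr1 (R : realType) (x : R) : 0 < x -> ln x <= x - 1.
Proof.
move=> x0; have -> : x = 1 + (x - 1) by ring.
rewrite (_ : 1 + (x - 1) - 1 = x - 1); last by ring.
by apply: le_ln1Dx; lra.
Qed.

(** Put [x = q i * expR (y i) / (p i * Z)] in [ln x <= x - 1] and multiply by [p i]. The resulting
    bounds [q i * expR (y i) / Z - p i] sum to zero. *)
Lemma gibbs_variational (R : realType) (I : finType) (p q y : I -> R) :
  (forall i, 0 <= p i) -> (forall i, 0 <= q i) ->
  (forall i, q i = 0 -> p i = 0) -> \sum_i p i = 1 ->
  \sum_i p i * (y i - ln (p i / q i)) <= ln (\sum_i q i * expR (y i)).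
Proof.
move=> p0 q0 pq p1; set Z := \sum_i q i * _.
have qe0 i : 0 <= q i * expR (y i) by rewrite mulr_ge0 // expR_ge0.
(* If [Z] were zero, every [q i] and hence, by domination, every [p i] would vanish, against total
   mass 1. *)
have Z0 : 0 < Z.
  rewrite lt_def sumr_ge0 // andbT; apply/eqP => /eqP.
  rewrite psumr_eq0 // => /allP Z0; move/eqP: p1; rewrite big1 => [|i _].
    by rewrite eq_sym oner_eq0.
  apply: pq; have := Z0 i (mem_index_enum _).
  by rewrite mulf_eq0 (gt_eqF (expR_gt0 _)) orbF => /eqP.
(* The added terms sum to zero; spreading [ln Z] in this way reduces the claim to one inequality per
   index. *)
have -> : ln Z = \sum_i (p i * ln Z + (q i * expR (y i) / Z - p i)).
  rewrite big_split /= sumrB -!mulr_suml p1 mul1r divff ?gt_eqF //.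
  by rewrite subrr addr0.
apply: ler_sum => i _.
have [pi0|pi_neq0] := eqVneq (p i) 0.
  by rewrite pi0 !mul0r add0r subr0 divr_ge0 // ltW.
have pi0 : 0 < p i by rewrite lt_def pi_neq0 p0.
have qi0 : 0 < q i.
  by rewrite lt_def q0 andbT; apply: contra_neq pi_neq0 => /pq.
have := @ln_le_subr1 R (expR (y i) / (p i / q i) / Z).
rewrite !divr_gt0 ?expR_gt0 // => /(_ isT).
rewrite !ln_div ?posrE ?divr_gt0 ?expR_gt0 // expRK -ln_div ?posrE // => le_ln.
have -> : q i * expR (y i) / Z - p i =
    p i * (expR (y i) / (p i / q i) / Z - 1).
  by field; rewrite !gt_eqF.
by rewrite -mulrDr ler_pM2l // -lerBlDl.
Qed.

(** * From policies to probabilities on state-action pairs *)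

Lemma policy_unavail (R : realType) (S A : finType) (Theta : Type)
    (M : ctmdp R S A Theta) (pi : policy M) s a :
  a \notin avail M s -> pi s a = 0.
Proof.
move=> aNs; have := fdist_sum1 (pi s).
rewrite (bigID (mem (avail M s))) /= policy_avail => /eqP.
rewrite -subr_eq0 [1 + _]addrC addrK psumr_eq0 => [|b _]; last exact: fdist_ge0.
by move=> /allP /(_ a (mem_index_enum _)); rewrite aNs => /eqP.
Qed.

(** Gibbs on pairs: [p] and [q] share the state marginal [c], which cancels in [p / q] and leaves
    the ratio [pi s a / mu s a] of [KL]. *)
Lemma entropic_risk_bound (R : realType) (S A : finType) (Theta : Type)
    (M : ctmdp R S A Theta) (pi : policy M) (mu : S -> fdist R A)
    (mu_supp : forall s a, (mu s a != 0) = (a \in avail M s))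
    (c : S -> R) (c_ge0 : forall s, 0 <= c s) (c_sum1 : \sum_s c s = 1)
    (tau : R) (tau_gt0 : 0 < tau) (delta : S -> A -> R) :
  \sum_s c s * (\sum_(a in avail M s) pi s a * delta s a - tau * KL pi mu s)
  <= tau * ln (\sum_s c s *
       \sum_(a in avail M s) mu s a * expR (delta s a / tau)).
Proof.
pose p (z : S * A) := c z.1 * pi z.1 z.2.
pose q (z : S * A) := c z.1 * mu z.1 z.2.
have mu_unavail s a : a \notin avail M s -> mu s a = 0.
  by rewrite -mu_supp negbK => /eqP.
have sum_avail s (h : A -> R) : (forall a, a \notin avail M s -> h a = 0) ->
    \sum_(a in avail M s) h a = \sum_a h a.
  move=> h0; rewrite [RHS](bigID (mem (avail M s))) /=.
  by rewrite [X in _ + X]big1 ?addr0 // => a /h0.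
have := @gibbs_variational R _ p q (fun z => delta z.1 z.2 / tau).
have p_ge0 z : 0 <= p z by rewrite mulr_ge0 // fdist_ge0.
have q_ge0 z : 0 <= q z by rewrite mulr_ge0 // fdist_ge0.
have pq z : q z = 0 -> p z = 0.
  move=> /eqP; rewrite mulf_eq0 => /orP[/eqP c0|mu0].
    by rewrite /p c0 mul0r.
  by rewrite /p policy_unavail ?mulr0 // -mu_supp mu0.
have p_sum1 : \sum_z p z = 1.
  rewrite -(pair_bigA _ (fun s a => c s * pi s a)) /= -[RHS]c_sum1.
  by apply: eq_bigr => s _; rewrite -mulr_sumr fdist_sum1 mulr1.
move=> /(_ p_ge0 q_ge0 pq p_sum1); rewrite -(ler_pM2l tau_gt0).
rewrite -(pair_bigA _ (fun s a => q (s, a) * expR (delta s a / tau))) /=.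
under [X in _ <= _ * ln X -> _]eq_bigr => s _.
  rewrite -(sum_avail s) => [|a aNs]; last first.
    by rewrite /q /= mu_unavail // mulr0 mul0r.
  under eq_bigr do rewrite /q /= -mulrA.
  rewrite -mulr_sumr; over.
(* The left-hand side of Gibbs, scaled by [tau], equals the one claimed; only this identity
   remains. *)
apply: le_trans; rewrite le_eqVlt; apply/orP; left; apply/eqP.
rewrite -(pair_bigA _ (fun s a => p (s, a) *
  (delta s a / tau - ln (p (s, a) / q (s, a))))) /= mulr_sumr.
apply: eq_bigr => s _; rewrite -(sum_avail s) => [|a aNs]; last first.
  by rewrite /p /= policy_unavail // mulr0 mul0r.
rewrite /KL !mulr_sumr -sumrB !mulr_sumr; apply: eq_bigr => a _.
rewrite /p /q /=.
(* At [c s = 0] nothing can be cancelled in [p / q], but both sides carry the factor [c s]. *)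
have [->|c0] := eqVneq (c s) 0; first by rewrite !mul0r mulr0.
rewrite -mulf_div divff // mul1r.
by field; rewrite gt_eqF.
Qed.

(** * Integrals of finite linear combinations and of the discount factor *)

Lemma integrable_lincomb {d} {T : measurableType d} {R : realType}
    (m : {measure set T -> \bar R}) (D : set T) (I : finType)
    (c : I -> R) (g : I -> T -> R) :
  measurable D -> (forall i, m.-integrable D (EFin \o g i)) ->
  m.-integrable D (fun x => (\sum_i c i * g i x)%:E).
Proof.
move=> mD ig.
under eq_fun do rewrite -sumEFin.
apply: integrable_sum => // i _.
under eq_fun do rewrite EFinM.
exact: (integrableZl mD (c i) (ig i)).
Qed.

Lemma Rintegral_lincomb {d} {T : measurableType d} {R : realType}
    (m : {measure set T -> \bar R}) (D : set T) (I : finType)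
    (c : I -> R) (g : I -> T -> R) :
  measurable D -> (forall i, m.-integrable D (EFin \o g i)) ->
  \int[m]_(x in D) (\sum_i c i * g i x) = \sum_i c i * \int[m]_(x in D) g i x.
Proof.
move=> mD ig; rewrite /Rintegral.
under eq_integral do rewrite -sumEFin.
rewrite integral_sum //; last first.
  move=> i; under eq_fun do rewrite EFinM.
  exact: (integrableZl mD (c i) (ig i)).
rewrite -sum_fine => [|i _]; last first.
  under eq_integral do rewrite EFinM.
  exact: (integrable_fin_num _ (integrableZl mD (c i) (ig i))).
apply: eq_bigr => i _; under eq_integral do rewrite EFinM.
rewrite (integralZl mD (ig i)) fineM //. exact: (integrable_fin_num _ (ig i)).
Qed.

(** The exponential density of rate [r] has total mass 1; divide by [r]. *)
Lemma integral_expR_discount (R : realType) (r : R) : 0 < r ->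
  (\int[lebesgue_measure]_(t in `[0%R, +oo[) (expR (- (r * t)))%:E = r^-1%:E)%E.
Proof.
move=> r0.
have me : measurable_fun setT (EFin \o (fun t : R => expR (- (r * t)))).
  apply/measurable_EFinP; apply: measurableT_comp => //.
  by apply: measurableT_comp => //; exact: measurable_funM.
have := integral_exponential_pdf r0.
rewrite [X in X = _ -> _](_ : _ =
    (\int[lebesgue_measure]_(t in `[0%R, +oo[) (r%:E * (expR (- (r * t)))%:E))%E).
  rewrite ge0_integralZl_EFin ?ltW //; last exact: measurable_funTS.
  move=> /(congr1 (mule r^-1%:E)).
  by rewrite muleA -EFinM mulVf ?gt_eqF // mul1e mule1.
rewrite [RHS]integral_mkcond; apply: eq_integral => t _.
by rewrite /exponential_pdf !patchE; case: ifP => // _; rewrite EFinM mulNr.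
Qed.

(** * Discounted occupation of right-continuous paths *)

Section discounted_occupancy.
Context {R : realType} {S : finType} {d : measure_display}
  {Omega : measurableType d}.
Variables (P : probability Omega R) (X : R -> Omega -> S) (r : R).
Hypothesis r_gt0 : 0 < r.
Hypothesis mX : forall (t : R) s, 0 <= t -> measurable [set w | X t w = s].
Hypothesis X_right_cont : forall w (t : R), 0 <= t ->
  \forall u \near t^'+, X u w = X t w.

(* By right continuity, the path takes the value [s] at time [t] iff for all
   large [n] it does so at the first multiple of [1/n] after [t], and the
   latter is a countable union of measurable rectangles. *)
Lemma measurable_path_eq s :
  measurable [set z : R * Omega | 0 <= z.1 /\ X z.1 z.2 = s].
Proof.
pose E n := \bigcup_k ((`[k%:R / n.+1%:R, k.+1%:R / n.+1%:R[ : set R) `*`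
   [set w | X (k.+1%:R / n.+1%:R) w = s]).
have mE n : measurable (E n).
  apply: bigcup_measurable => k _; apply: measurableX.
    exact: measurable_itv.
  by apply: mX; rewrite divr_ge0.
(* The right end of the grid cell of mesh [1/(n+1)] that contains [t]. *)
pose u n (t : R) := (Num.truncn (t * n.+1%:R)).+1%:R / n.+1%:R : R.
have EP n t w : E n (t, w) <-> 0 <= t /\ X (u n t) w = s.
  have n0 : (0 : R) < n.+1%:R by rewrite ltr0n.
  split=> [[k _ [/= tk Xs]]|[t0 Xs]].
    move: tk; rewrite in_itv /= ler_pdivrMr // ltr_pdivlMr // => /andP[kt tk].
    have t0 : 0 <= t by rewrite -(pmulr_lge0 _ n0) (le_trans _ kt).
    split => //; rewrite /u; have -> // : Num.truncn (t * n.+1%:R) = k.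
    by apply: truncn_def; rewrite kt tk.
  exists (Num.truncn (t * n.+1%:R)) => //; split => //=.
  rewrite in_itv /= ler_pdivrMr // ltr_pdivlMr //.
  by apply: truncn_itv; rewrite mulr_ge0.
have Xu t w : 0 <= t -> \forall n \near \oo, X (u n t) w = X t w.
  move=> t0; have [e /= e0 eX] := X_right_cont w t t0.
  have [N _ HN] := near_infty_natSinv_lt (PosNum e0).
  exists N => // n /HN /= ne.
  have n0 : (0 : R) < n.+1%:R by rewrite ltr0n.
  have /andP[l g] : (Num.truncn (t * n.+1%:R))%:R <= t * n.+1%:R <
     (Num.truncn (t * n.+1%:R)).+1%:R by apply: truncn_itv; rewrite mulr_ge0.
  (* Strictness matters: the filter [t^'+] says nothing about [t] itself. *)
  have tu : t < u n t by rewrite /u ltr_pdivlMr.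
  apply: eX => //=; rewrite distrC gtr0_norm ?subr_gt0 //.
  apply: le_lt_trans ne; rewrite lerBlDr /u ler_pdivrMr // mulrDl.
  by rewrite mulVf ?gt_eqF // -natr1 addrC lerD2l.
(* The set is the lower limit of the [E n], since [X (u n t) w] is eventually [X t w]. *)
rewrite (_ : [set _ | _] = \bigcup_N \bigcap_(n in [set n | (N <= n)%N]) E n).
  apply: bigcup_measurable => N _; apply: bigcap_measurable => //.
  by exists N => /=.
apply/seteqP; split => [[t w] /= [t0 Xs]|[t w] [N _ HN] /=].
  have [N _ HN] := Xu t w t0; exists N => // n /= Nn.
  by apply/EP; split => //; rewrite HN.
have t0 : 0 <= t by have /EP[] := HN N (leqnn N).
have [N' _ HN'] := Xu t w t0; split => //.
have /EP[_ <-] := HN (maxn N N') (leq_maxl _ _).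
by rewrite HN' //= leq_maxr.
Qed.

Definition occupation_time s w : R := \int[lebesgue_measure]_(t in `[0, +oo[)
  (expR (- (r * t)) * (X t w == s)%:R).

(** The discounted integrand, extended by 0 to negative times so that joint measurability and
    Tonelli apply on all of [R * Omega]. *)
Let g s (z : R * Omega) : R :=
  expR (- (r * z.1)) * \1_[set z | 0 <= z.1 /\ X z.1 z.2 = s] z.

Let mg s : measurable_fun setT (g s).
Proof.
apply: measurable_funM; last first.
  by apply/measurable_indicP; exact: measurable_path_eq.
apply: measurableT_comp => //; apply: measurableT_comp => //.
by apply: measurable_funM => //; exact: measurable_fst.
Qed.

Let gE s t w : 0 <= t -> g s (t, w) = expR (- (r * t)) * (X t w == s)%:R.
Proof.
move=> t0; rewrite /g indicE /=; congr (_ * _%:R); congr nat_of_bool.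
apply/idP/eqP; first by rewrite inE /= => -[].
by rewrite inE.
Qed.

Lemma integrable_expR_discount :
  lebesgue_measure.-integrable `[0, +oo[ (fun t : R => (expR (- (r * t)))%:E).
Proof.
apply/integrableP; split.
  apply/measurable_EFinP; apply: measurable_funTS.
  apply: measurableT_comp => //.
  by apply: measurableT_comp => //; exact: measurable_funM.
under eq_integral do rewrite gee0_abs ?lee_fin ?expR_ge0 //.
by rewrite integral_expR_discount // ltry.
Qed.

Lemma integrable_discounted_path s w : lebesgue_measure.-integrable `[0, +oo[
  (fun t : R => (expR (- (r * t)) * (X t w == s)%:R)%:E).
Proof.
apply: (le_integrable _ _ _ integrable_expR_discount) => //.
  apply/measurable_EFinP.
  apply: (eq_measurable_fun (fun t => g s (t, w))).
    by move=> t; rewrite inE /= in_itv /= andbT => t0; rewrite gE.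
  apply: measurable_funTS.
  exact: (@measurable_fun_pair1 _ _ _ _ _ _ (g s) w (mg s)).
move=> t _; rewrite lee_fin ger0_norm ?mulr_ge0 ?expR_ge0 //.
by rewrite ger0_norm ?expR_ge0 // ler_piMr ?expR_ge0 // lern1 leq_b1.
Qed.

(** By Tonelli, integrating the jointly measurable nonnegative [g s] over time leaves a measurable
    function of the path. *)
Lemma measurable_occupation_time s : measurable_fun setT (occupation_time s).
Proof.
have mG : measurable_fun setT (fubini_G lebesgue_measure (EFin \o g s)).
  apply: measurable_fun_fubini_tonelli_G.
    by apply/measurable_EFinP; exact: mg.
  by move=> z; rewrite lee_fin mulr_ge0 // expR_ge0.
rewrite (_ : occupation_time s =
  fine \o fubini_G lebesgue_measure (EFin \o g s)).
  by apply: measurableT_comp => //; exact: fine_measurable.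
apply/funext => w; rewrite /occupation_time /Rintegral /= /fubini_G.
congr fine; rewrite [LHS]integral_mkcond; apply: eq_integral => t _.
rewrite patchE mem_setE in_itv /= andbT; case: ifPn => [t0|tN0].
  by rewrite gE.
by rewrite /g indicE memNset ?mulr0 //= => -[t0]; rewrite t0 in tN0.
Qed.

Lemma occupation_time_ge0 s w : 0 <= occupation_time s w.
Proof. by apply: Rintegral_ge0 => t _; rewrite mulr_ge0 // expR_ge0. Qed.

(** Expand [f (X t w)] over the indicators of the finitely many states and use linearity. *)
Lemma occupation_time_sum (f : S -> R) w :
  \int[lebesgue_measure]_(t in `[0, +oo[) (expR (- (r * t)) * f (X t w))
  = \sum_s f s * occupation_time s w.
Proof.
rewrite -Rintegral_lincomb //; last first.
  by move=> s; exact: integrable_discounted_path.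
apply: eq_Rintegral => t _; rewrite (bigD1 (X t w)) //= eqxx mulr1 mulrC.
by rewrite big1 ?addr0 // => s /negPf sX; rewrite eq_sym sX !mulr0.
Qed.

Lemma sum_occupation_time w : \sum_s occupation_time s w = r^-1.
Proof.
have := occupation_time_sum (fun=> 1) w.
under eq_bigr do rewrite mul1r.
move=> <-; rewrite /Rintegral; under eq_integral do rewrite mulr1.
by rewrite integral_expR_discount.
Qed.

(** Nonnegative occupation times summing to [r^-1] are each bounded by [r^-1], which is integrable
    under a probability. *)
Lemma integrable_occupation_time s :
  P.-integrable setT (EFin \o occupation_time s).
Proof.
apply: (@le_integrable _ _ _ P _ _ _ (cst (r^-1)%:E)) => //.
- by apply/measurable_EFinP; exact: measurable_occupation_time.
- move=> w _; rewrite lee_fin !ger0_norm ?invr_ge0 ?(ltW r_gt0) //;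
    last exact: occupation_time_ge0.
  rewrite -(sum_occupation_time w) (bigD1 s) //= lerDl sumr_ge0 // => s' _.
  exact: occupation_time_ge0.
- exact: finite_measure_integrable_cst.
Qed.

Lemma discountedE (f : S -> R) :
  discounted P X r f = (\sum_s f s * Rintegral P setT (occupation_time s))%:E.
Proof.
rewrite /discounted unlock; under eq_integral do rewrite occupation_time_sum.
rewrite -(Rintegral_lincomb P) //; last exact: integrable_occupation_time.
rewrite fineK // integrable_fin_num //; apply: integrable_lincomb => //.
exact: integrable_occupation_time.
Qed.

Lemma occupancyE s :
  occupancy P X r s = r * Rintegral P setT (occupation_time s).
Proof.
rewrite /occupancy discountedE /=; congr (_ * _).
rewrite (bigD1 s) //= eqxx mul1r big1 ?addr0 // => s' /negPf ->.
by rewrite mul0r.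
Qed.

Lemma occupancy_ge0 s : 0 <= occupancy P X r s.
Proof.
rewrite occupancyE mulr_ge0 ?(ltW r_gt0) // Rintegral_ge0 // => w _.
exact: occupation_time_ge0.
Qed.

Lemma discounted_occupancy (f : S -> R) :
  discounted P X r f = (r^-1 * \sum_s occupancy P X r s * f s)%:E.
Proof.
rewrite discountedE; congr EFin; rewrite mulr_sumr; apply: eq_bigr => s _.
by rewrite occupancyE; field; rewrite gt_eqF.
Qed.

Lemma sum_occupancy : \sum_s occupancy P X r s = 1.
Proof.
under eq_bigr do rewrite occupancyE -[Rintegral _ _ _]mul1r.
rewrite -mulr_sumr -Rintegral_lincomb //;
  last exact: integrable_occupation_time.
under eq_Rintegral => w _.
  under eq_bigr do rewrite mul1r.
  rewrite sum_occupation_time; over.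
rewrite Rintegral_cst //.
rewrite [X in fine X](_ : _ = 1%E); last exact: probability_setT.
by rewrite /= mulr1 divff // gt_eqF.
Qed.

End discounted_occupancy.

(** * Robust lower bound and worst-case reward *)

Theorem theorem3p1 (R : realType) (S A : finType) (Theta : Type)
    (M : ctmdp R S A Theta) (theta : Theta) (rho : fdist R S) (r : R)
    (r_gt0 : 0 < r)
    (mu : S -> fdist R A)
    (mu_supp : forall s a, (mu s a != 0) = (a \in avail M s))
    (d : measure_display) (Omega : measurableType d) (X : R -> Omega -> S)
    (P : policy M -> Theta -> probability Omega R)
    (P_ctmc : forall pi th, is_ctmc rho (generator pi th) (P pi th) X)
    (reward_only : forall th s s' a, a \in avail M s ->
       rate M th s a s' = rate M theta s a s')
    (pi : policy M) (tau eps : R) (tau_gt0 : 0 < tau) (eps_ge0 : 0 <= eps) :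
  let C := ambiguity_set M (P pi theta) X r mu tau eps theta in
  let V := value (P pi theta) X r pi in
  let J := reg_value (P pi theta) X r mu tau pi theta in
  (J - (eps / r)%:E <= ereal_inf [set V th | th in C])%E /\
  (forall theta_star : Theta,
     (* in extended reals, so that log 0 = -oo when pi s a = 0 *)
     (forall s a, a \in avail M s ->
        (reward M theta_star s a)%:E
        = ((reward M theta s a)%:E - tau%:E * lne (pi s a / mu s a)%:E
           - eps%:E)%E) ->
     [/\ ereal_inf [set V th | th in C] = (J - (eps / r)%:E)%E,
         C theta_star
       & V theta_star = ereal_inf [set V th | th in C]]).
Proof.
move=> C V J.
have mX := ctmc_meas (P_ctmc pi theta).
have rcX := ctmc_right_cont (P_ctmc pi theta).
pose occ := occupancy (P pi theta) X r.
have occ1 : \sum_s occ s = 1 by exact: sum_occupancy.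
have discE f : discounted (P pi theta) X r f = (r^-1 * \sum_s occ s * f s)%:E.
  exact: discounted_occupancy.
have lower_bound : (J - (eps / r)%:E <= ereal_inf [set V th | th in C])%E.
  apply: le_ereal_inf_tmp => _ [th Cth <-].
  rewrite /J /V /reg_value /value !discE -EFinB lee_fin [eps / r]mulrC -mulrBr.
  rewrite ler_pM2l ?invr_gt0 // lerBlDl -lerBlDr.
  (* Membership in [C] bounds by [eps] the entropic risk of the reward loss from [theta] to [th]. *)
  apply: le_trans Cth; apply: le_trans; last first.
    apply: (@entropic_risk_bound R S A Theta M pi mu mu_supp occ _ occ1) => // s.
    exact: occupancy_ge0.
  rewrite -sumrB; apply: ler_sum => s _; rewrite -mulrBr addrAC -sumrB.
  by under [X in _ <= _ * (X - _)]eq_bigr do rewrite mulrBr.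
split=> // th thE.
have mu0 s a : a \in avail M s -> 0 < mu s a.
  by move=> sa; rewrite lt_def mu_supp sa fdist_ge0.
(* At [pi s a = 0] the prescribed reward would be [+oo], whereas rewards are real. *)
have pi0 s a : a \in avail M s -> 0 < pi s a.
  move=> sa; rewrite lt_def fdist_ge0 andbT; apply/eqP => pi0.
  have := thE s a sa; rewrite pi0 mul0r le0_lneNy //.
  by rewrite gt0_muleNy ?lte_fin.
have rewardE s a : a \in avail M s ->
    reward M th s a = reward M theta s a - tau * ln (pi s a / mu s a) - eps.
  move=> sa; have := thE s a sa.
  by rewrite lne_EFin ?divr_gt0 ?pi0 ?mu0 // -EFinM -!EFinB => -[].
(* The exponential is [pi s a / mu s a * expR (eps / tau)]. The weight [mu s a] cancels and the
   averages over [pi] and [occ] have mass 1, so the constraint holds with equality. *)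
have Cth : C th.
  rewrite /C /ambiguity_set /= (_ : \sum_s _ = expR (eps / tau)).
    by rewrite expRK mulrC divfK // gt_eqF.
  rewrite -[RHS]mul1r -occ1 mulr_suml; apply: eq_bigr => s _; congr (_ * _).
  rewrite -[RHS]mul1r -(policy_avail pi s) mulr_suml; apply: eq_bigr => a sa.
  rewrite rewardE // (_ : _ / tau = ln (pi s a / mu s a) + eps / tau).
    rewrite expRD lnK ?posrE ?divr_gt0 ?pi0 ?mu0 // mulrA; congr (_ * _).
    by rewrite mulrC divfK // gt_eqF ?mu0.
  by field; rewrite gt_eqF.
have VE : V th = (J - (eps / r)%:E)%E.
  rewrite /J /V /reg_value /value !discE -EFinB; congr EFin.
  rewrite [eps / r]mulrC -mulrBr; congr (_ * _).
  rewrite -[eps]mul1r -occ1 mulr_suml -sumrB; apply: eq_bigr => s _.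
  rewrite -mulrBr; congr (_ * _).
  rewrite -[eps]mul1r -(policy_avail pi s) mulr_suml /KL mulr_sumr -!sumrB.
  by apply: eq_bigr => a sa; rewrite rewardE //; ring.
(* The lower bound is the value of the member [th] of [C], hence the infimum. *)
have infE : ereal_inf [set V th | th in C] = (J - (eps / r)%:E)%E.
  apply/eqP; rewrite eq_le lower_bound andbT -VE.
  by apply: ereal_inf_lbound; exists th.
by split; rewrite ?VE.
Qed.
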